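(* Let $n$ be a positive integer and let $r$ be a positive integer with $r\equiv 2 \pmod{\phi\left(\binom{2n}{n}\right)\binom{2n}{n}}$. Then $$\nu_p\left(\sum_{k=0}^{2n}(-1)^k\binom{2n}{k}^r\right)=\nu_p\left(\binom{2n}{n}\right)$$ for each prime divisor $p$ of $\binom{2n}{n}$.
   Context: $\phi$ is the Euler totient function. For a prime $p$ and an integer $m\neq 0$, $\nu_p(m)$ is the greatest integer such that $p^{\nu_p(m)}\mid m$; $\nu_p(0)=+\infty$. *)

(* Defs.v *)
From mathcomp Require Import all_boot all_order all_algebra.

Set Implicit Arguments.
Unset Strict Implicit.
Unset Printing Implicit Defensive.

(* [None] stands for +oo, the valuation of 0 ([logn p 0] would be 0). *)
Definition padic_val (p : nat) (m : int) : option nat :=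
  if m == 0%R then None else Some (logn p `|m|%N).

Lemma padic_valP (p : nat) (m : int) (a : nat) : prime p ->
  padic_val p m = Some a <-> (p ^ a %| `|m|) && ~~ (p ^ a.+1 %| `|m|).
Proof.
move=> pr_p; rewrite /padic_val; case: eqP => [->|/eqP m0].
  by rewrite /= !dvdn0.
have m_gt0 : 0 < `|m| by rewrite absz_gt0.
rewrite !pfactor_dvdn // -ltnNge ltnS -eqn_leq eq_sym.
by split=> [[->]|/eqP ->].
Qed.

(* Main.v *)
Require Import Defs.
From mathcomp Require Import all_boot all_order all_algebra all_solvable.
From mathcomp Require Import zify ring.

(** Let B = C(2n, n), a = v_p(B), and let S_r be the sum in question.  Since
    S_2 = (-1)^n B, it suffices for odd p to show S_r = S_2 mod p^(a+1).  The
    terms prime to p have the same r-th and second powers modulo p^(a+1) by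
    Euler's theorem, so the point is that, for every r >= 2, the terms divisible
    by p add up to a multiple of p^(a+1), although they are not so individually.

    Consider more generally the sums of (-1)^k C(M, k)^r g(k), where g is
    "p-adically smooth" (its finite differences are highly divisible by p) and
    g(M - k) = (-1)^M g(k).  Writing k = p x + b and M = p M' + M0 and summing
    over the last digit b gives such a sum for M' (digits b <= M0) plus
    (p M')^r times such a sum for M' - 1 (digits b > M0).  When M is odd, g is
    antisymmetric, hence divisible by p, so one factor p is gained for each odd
    quotient M %/ p^i; for M = 2n there are exactly a of those by Legendre's
    formula.  The terms with b > M0 carry at least one factor p more.

    For p = 2 (then r is even) the terms divisible by 2 vanish modulo 2^(a+1) as
    soon as r > a, and the same recursion shows that the sum of the odd terms is
    2^a modulo 2^(a+1). *)

Set Implicit Arguments.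
Unset Strict Implicit.
Unset Printing Implicit Defensive.
Import GRing.Theory Num.Theory.
Local Open Scope ring_scope.

(** * Functions with highly divisible differences *)

(* Equivalently, p ^ uphalf (m - c) divides the m-th finite difference of f
   at x whenever x + m <= M. *)
Fixpoint flat (p c M : nat) (f : nat -> int) : Prop :=
  if M is M1.+1 then
    if c is c1.+1 then flat p c1 M1 (fun x => f x.+1 - f x)
    else exists2 g, flat p 1 M1 g
           & forall x, (x <= M1)%N -> f x.+1 - f x = p%:Z * g x
  else True.

Section Flat.

Variable p : nat.

Lemma flat_ext c M f g :
  (forall x, (x <= M)%N -> f x = g x) -> flat p c M f -> flat p c M g.
Proof.
elim: M c f g => [//|M IH] [|c] f g fg.
  by move=> [h hM hE]; exists h => // x xM; rewrite -!fg ?hE //; lia.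
by apply: IH => x xM; rewrite !fg //; lia.
Qed.

Lemma flatW c M f : flat p c M.+1 f -> flat p c M f.
Proof.
elim: M c f => [//|M IH] [|c] f; last exact: IH.
by move=> [h hM hE]; exists h; [exact: IH|move=> x xM; apply: hE; lia].
Qed.

Lemma flat_le c M N f : (N <= M)%N -> flat p c M f -> flat p c N f.
Proof.
move=> NM; rewrite -(subnK NM); elim: (M - N)%N => [//|d IH] fl.
by apply: IH; apply: flatW.
Qed.

Lemma flatS c M f : flat p c M.+1 f -> flat p c M (fun x => f x.+1).
Proof.
elim: M c f => [//|M IH] [|c] f; last exact: IH.
move=> [h hM hE]; exists (fun x => h x.+1); first exact: IH.
by move=> x xM; apply: hE.
Qed.

Lemma flat_shift c a M f :
  flat p c (a + M) f -> flat p c M (fun x => f (x + a)%N).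
Proof.
elim: a f => [|a IH] f fl.
  by apply: flat_ext fl => x _; rewrite addn0.
by apply: flat_ext (IH _ (flatS fl)) => x _; rewrite addnS.
Qed.

Lemma flat_cst c M a : flat p c M (fun=> a).
Proof.
elim: M c a => [//|M IH] [|c] a /=; last first.
  by apply: flat_ext (IH c 0) => x _; rewrite subrr.
by exists (fun=> 0) => // x _; rewrite subrr mulr0.
Qed.

Lemma flatD c M f g :
  flat p c M f -> flat p c M g -> flat p c M (fun x => f x + g x).
Proof.
elim: M c f g => [//|M IH] [|c] f g.
  move=> [f1 f1M fE] [g1 g1M gE].
  exists (fun x => f1 x + g1 x); first exact: IH.
  by move=> x xM; rewrite mulrDr -fE // -gE //; ring.
by move=> fM gM; apply: flat_ext (IH _ _ _ fM gM) => x _ /=; ring.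
Qed.

Lemma flatZ c M a f : flat p c M f -> flat p c M (fun x => a * f x).
Proof.
elim: M c f => [//|M IH] [|c] f.
  move=> [g gM gE]; exists (fun x => a * g x); first exact: IH.
  by move=> x xM; rewrite -mulrBr gE // mulrCA.
by move=> fM; apply: flat_ext (IH _ _ fM) => x _ /=; rewrite mulrBr.
Qed.

Lemma flat_succ c M f : flat p c M f -> flat p c.+1 M f.
Proof.
have [n] := ubnP M; elim: n M c f => // n IH [//|M] [|c] f Mn; last exact: (IH M c).
move=> [g gM gE] /=; apply: (@flat_ext _ _ (fun x => p%:Z * g x)) => [x xM|].
  by rewrite gE.
case: M Mn gM gE => [//|M] Mn gM gE.
exists (fun x => g x.+1 - g x); last by move=> x _; rewrite -mulrBr.
by apply: IH => //; lia.
Qed.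

Lemma flat_mulp c M f : flat p c.+2 M f -> flat p c M (fun x => p%:Z * f x).
Proof.
elim: M c f => [//|M IH] [|c] f fM; last first.
  by apply: flat_ext (IH _ _ fM) => x _; rewrite mulrBr.
by exists (fun x => f x.+1 - f x) => // x _; rewrite mulrBr.
Qed.

Lemma flat_divp M f : (0 < p)%N -> flat p 0 M (fun x => p%:Z * f x) -> flat p 2 M f.
Proof.
case: M => [//|M] p_gt0 [h hM hE]; apply: flat_ext hM => x xM.
have p_neq0 : p%:Z != 0 by rewrite eqz_nat -lt0n.
by apply: (mulfI p_neq0); rewrite -hE //; ring.
Qed.

(** The Leibniz rule [DM] splits the difference of the product. When exactly one index is 0, the
    difference of that factor carries a [p], and [flat_mulp] trades this [p] for the two surplus
    units of index. *)
Lemma flatM c d M f g : flat p c M f -> flat p d M g ->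
  flat p (c + d) M (fun x => f x * g x).
Proof.
elim: M c d f g => [//|M IH] c d f g fM gM.
have DM x : f x.+1 * g x.+1 - f x * g x =
  f x.+1 * (g x.+1 - g x) + (f x.+1 - f x) * g x by ring.
have [fS gW] := (flatS fM, flatW gM).
case: c fM fS => [|c] fM fS; case: d gM gW => [|d] gM gW.
- have [[f1 f1M fE] [g1 g1M gE]] := (fM, gM).
  exists (fun x => f x.+1 * g1 x + f1 x * g x).
    exact: flatD (IH _ _ _ _ fS g1M) (IH _ _ _ _ f1M gW).
  by move=> x xM; rewrite DM fE // gE //; ring.
- have [f1 f1M fE] := fM.
  apply: flat_ext (flatD (IH _ _ _ _ fS gM) (flat_mulp (IH _ _ _ _ f1M gW))).
  by move=> x xM; rewrite DM fE //; ring.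
- have [g1 g1M gE] := gM; rewrite addn0.
  have fg1 : flat p c M (fun x => p%:Z * (f x.+1 * g1 x)).
    by apply: flat_mulp; rewrite -[c.+2]addn1; apply: IH.
  have := IH _ _ _ _ fM gW; rewrite addn0 => /(flatD fg1); apply: flat_ext => x xM.
  by rewrite DM gE //; ring.
have := IH _ _ _ _ fS gM; rewrite addSnnS => fg1.
have fg2 := IH _ _ _ _ fM gW.
by apply: flat_ext (flatD fg1 fg2) => x xM; rewrite DM.
Qed.

Lemma flatX M f n : flat p 0 M f -> flat p 0 M (fun x => f x ^+ n).
Proof.
move=> fM; elim: n => [|n IH]; first exact: flat_cst.
by apply: flat_ext (flatM fM IH) => x _; rewrite exprS.
Qed.

Lemma flat_sum c M (I : Type) (s : seq I) (P : pred I) (F : I -> nat -> int) :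
  (forall i, P i -> flat p c M (F i)) ->
  flat p c M (fun x => \sum_(i <- s | P i) F i x).
Proof.
move=> FM; elim: s => [|i s IH].
  by apply: flat_ext (flat_cst c M 0) => x _; rewrite big_nil.
have [Pi|nPi] := boolP (P i).
  by apply: flat_ext (flatD (FM i Pi) IH) => x _; rewrite big_cons Pi.
by apply: flat_ext IH => x _; rewrite big_cons (negPf nPi).
Qed.

Lemma flat_prod M (I : Type) (s : seq I) (F : I -> nat -> int) :
  (forall i, flat p 0 M (F i)) -> flat p 0 M (fun x => \prod_(i <- s) F i x).
Proof.
move=> FM; elim: s => [|i s IH].
  by apply: flat_ext (flat_cst 0 M 1) => x _; rewrite big_nil.
by apply: flat_ext (flatM (FM i) IH) => x _; rewrite big_cons.
Qed.

Lemma flat_rev c M f : flat p c M f -> flat p c M (fun x => f (M - x)%N).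
Proof.
elim: M c f => [//|M IH] [|c] f.
  move=> [g gM gE].
  exists (fun x => -1 * g (M - x)%N); first exact/flatZ/IH.
  move=> x xM; rewrite subSS subSn // mulrCA -gE; last by lia.
  by rewrite mulN1r opprB.
move=> /IH /(flatZ (-1)) /=; apply: flat_ext => x xM.
by rewrite subSS subSn // mulN1r opprB.
Qed.

Lemma flat_id M : flat p 1 M Posz.
Proof.
case: M => [//|M] /=; apply: flat_ext (flat_cst 0 M 1) => x _.
by rewrite intS; ring.
Qed.

Lemma flat_affine M c : flat p 0 M (fun x => (p * x + c)%N%:Z).
Proof.
apply: flat_ext (flatD (flat_mulp (flat_succ (flat_id M))) (flat_cst 0 M c%:Z)).
by move=> x _; rewrite PoszD PoszM.
Qed.

Lemma diff_telescope (f : nat -> int) x n :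
  f (x + n)%N = f x + \sum_(i < n) (f (x + i).+1 - f (x + i)%N).
Proof.
elim: n => [|n IH]; first by rewrite big_ord0 !addn0 addr0.
by rewrite big_ord_recr /= addrA -IH addnS; ring.
Qed.

(** A step of length [p] is a sum of [p] first differences, all congruent mod [p], so a factor [p]
    comes out. The quotient [g] again has index 1, so the induction applies to it. *)
Lemma flat_decimate10 M N a f : (0 < p)%N -> (p * N + a <= M)%N ->
  flat p 1 M f -> flat p 0 N (fun x => f (p * x + a)%N).
Proof.
move=> p_gt0; elim: N M f => [//|N IH] M f leM fM.
have [M1 defM] : exists M1, M = M1.+1 by exists M.-1; nia.
rewrite {M}defM in leM fM; pose d x := f x.+1 - f x.
have dM : flat p 0 M1 d by [].
have [d1 d1M dE] : exists2 d1, flat p 1 M1.-1 d1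
    & forall x, (x < M1)%N -> d x.+1 - d x = p%:Z * d1 x.
  case: (M1) dM => [_|M2 [d1 d1M dE]]; first by exists (fun=> 0).
  by exists d1.
pose g y := d y + \sum_(i < p) \sum_(j < i) d1 (y + j)%N.
have gE x : (x + p <= M1.+1)%N -> f (x + p)%N - f x = p%:Z * g x.
  move=> xp; rewrite diff_telescope addrC addKr mulrDr mulr_sumr.
  have -> : p%:Z * d x = \sum_(i < p) d x.
    by rewrite sumr_const card_ord -mulr_natl natz.
  rewrite -big_split /=; apply: eq_bigr => i _; rewrite -/(d _) diff_telescope.
  rewrite mulr_sumr; congr (_ + _); apply: eq_bigr => j _; apply: dE.
  by have := ltn_ord i; have := ltn_ord j; lia.
exists (fun x => g (p * x + a)%N); last first.
  move=> x xN; rewrite -gE; last by nia.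
  by congr (f _ - _); lia.
apply: flat_succ; apply: (IH (M1.+1 - p)%N); first by lia.
apply: flatD; first by apply: flat_succ; apply: flat_le dM; lia.
apply: flat_sum => i _; apply: flat_sum => j _; apply: flat_shift.
by apply: flat_le d1M; have := ltn_ord i; have := ltn_ord j; nia.
Qed.

(** Index 2 makes only the third differences divisible by [p], so a step of length [p] is expanded
    to one order more. The quotient [g] has index 1, and [flat_decimate10] takes over. *)
Lemma flat_decimate20 M N a f : (1 < p)%N -> odd p -> (p * N + a <= M)%N ->
  flat p 2 M f -> flat p 0 N (fun x => f (p * x + a)%N).
Proof.
move=> p_gt1 p_odd; case: N => [//|N] leM fM.
have [M1 defM] : exists M1, M = M1.+1 by exists M.-1; nia.
rewrite {M}defM in leM fM; pose d x := f x.+1 - f x; pose e x := d x.+1 - d x.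
have dM : flat p 1 M1 d by [].
have eM : flat p 0 M1.-1 e by case: (M1) dM.
have [e1 e1M eE] : exists2 e1, flat p 1 M1.-2 e1
    & forall x, (x.+1 < M1)%N -> e x.+1 - e x = p%:Z * e1 x.
  case: (M1) eM => [|[|M2]] /=; try by move=> _; exists (fun=> 0).
  by move=> [e1 e1M eE]; exists e1.
(* The second difference [e] occurs with coefficient [C(p, 2)], the sum of all [i < p]; for odd [p]
   this is [p] times [p.-1./2]. *)
pose g y := d y + (p.-1./2)%:Z * e y +
  \sum_(i < p) \sum_(j < i) \sum_(l < j) e1 (y + l)%N.
have gE x : (x + p <= M1.+1)%N -> f (x + p)%N - f x = p%:Z * g x.
  move=> xp; rewrite diff_telescope addrC addKr mulrDr mulr_sumr.
  have -> : p%:Z * (d x + (p.-1./2)%:Z * e x) =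
      \sum_(i < p) (d x + i%:Z * e x).
    rewrite big_split /= sumr_const card_ord -mulr_natl natz mulrDr.
    congr (_ + _); rewrite -mulr_suml mulrA; congr (_ * _).
    rewrite -PoszM; transitivity ((\sum_(i < p) i)%N%:Z).
      by rewrite -(big_mkord xpredT id) bin2_sum bin2odd.
    by rewrite (big_morph Posz PoszD (erefl _)).
  rewrite -big_split /=; apply: eq_bigr => i _; rewrite -/(d _) diff_telescope.
  rewrite -[RHS]addrA mulr_sumr; congr (_ + _).
  have -> : i%:Z * e x = \sum_(j < i) e x.
    by rewrite sumr_const card_ord -mulr_natl natz.
  rewrite -big_split /=; apply: eq_bigr => j _; rewrite -/(e _) diff_telescope.
  rewrite mulr_sumr; congr (_ + _); apply: eq_bigr => l _; apply: eE.
  by have := ltn_ord i; have := ltn_ord j; have := ltn_ord l; lia.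
exists (fun x => g (p * x + a)%N); last first.
  move=> x xN; rewrite -gE; last by nia.
  by congr (f _ - _); lia.
apply: flat_succ; apply: (@flat_decimate10 (M1.+1 - p)%N); try by lia.
apply: flatD; first apply: flatD.
- by apply: flat_le dM; lia.
- by apply/flat_succ/flatZ; apply: flat_le eM; lia.
apply: flat_sum => i _; apply: flat_sum => j _; apply: flat_sum => l _.
apply: flat_shift.
apply: flat_le e1M; have := ltn_ord i; have := ltn_ord j; have := ltn_ord l.
by nia.
Qed.

End Flat.

(** * The prime-to-p part of the factorial *)

Definition fact_pfree (p n : nat) : nat :=
  (\prod_(1 <= i < n.+1 | ~~ (p %| i)) i)%N.

Section PFreeFactorial.

Variable p : nat.
Hypothesis p_prime : prime p.

Let p_gt0 : (0 < p)%N := prime_gt0 p_prime.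

Lemma fact_pfreeS n : fact_pfree p n.+1 =
  (fact_pfree p n * (if p %| n.+1 then 1 else n.+1))%N.
Proof.
by rewrite /fact_pfree [LHS]big_mkcond big_nat_recr //= -big_mkcond if_neg.
Qed.

Lemma coprime_fact_pfree n : coprime p (fact_pfree p n).
Proof.
elim: n => [|n IH]; first by rewrite /fact_pfree big_geq ?coprimen1.
rewrite fact_pfreeS coprimeMr IH /=; case: ifP => [_|ndvd].
  exact: coprimen1.
by rewrite prime_coprime // ndvd.
Qed.

Lemma fact_pfreeE n : n`! = (p ^ (n %/ p) * (n %/ p)`! * fact_pfree p n)%N.
Proof.
elim: n => [|n IH]; first by rewrite div0n /fact_pfree big_geq.
rewrite factS IH fact_pfreeS divnS //; case: ifP => dvd /=.
  have := divnK dvd; rewrite divnS // dvd add1n => {1}<-.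
  by rewrite factS expnS; ring.
by rewrite add0n; ring.
Qed.

(** Divide the factorizations [fact_pfreeE] of the three factorials. If the last digit of [k]
    exceeds that of [M], the subtraction borrows and [(M - k) %/ p] drops by one, which leaves over
    one [p] and the factor [M %/ p]. *)
Lemma bin_pfree M k : (k <= M)%N ->
  ('C(M, k) * (fact_pfree p k * fact_pfree p (M - k)) =
   (if k %% p <= M %% p then 'C(M %/ p, k %/ p)
    else p * (M %/ p) * 'C((M %/ p).-1, k %/ p)) * fact_pfree p M)%N.
Proof.
move=> kM; have := bin_fact kM.
rewrite (fact_pfreeE k) (fact_pfreeE (M - k)) (fact_pfreeE M).
set a := fact_pfree p k; set b := fact_pfree p (M - k); set c := fact_pfree p M.
have Mlt := ltn_pmod M p_gt0; have klt := ltn_pmod k p_gt0.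
have defM := divn_eq M p; have defk := divn_eq k p.
have kM' : (k %/ p <= M %/ p)%N by apply: leq_div2r.
have pf_gt0 m n i j : (0 < p ^ m * p ^ n * (i`! * j`!))%N.
  by rewrite !muln_gt0 !expn_gt0 p_gt0 !fact_gt0.
set u := 'C(M, k).
have cancel P Q X Y v : (u * (P * X * a * (Q * Y * b)) = Q * P * (v * (X * Y)) * c ->
    Q * P * (X * Y) * (u * (a * b)) = Q * P * (X * Y) * (v * c))%N.
  move=> E; transitivity (u * (P * X * a * (Q * Y * b)))%N; first by ring.
  by rewrite E; ring.
case: leqP => le0.
  have -> : ((M - k) %/ p = M %/ p - k %/ p)%N.
    have -> : (M - k = (M %/ p - k %/ p) * p + (M %% p - k %% p))%N by nia.
    by rewrite divnMDl // [X in (_ + X)%N]divn_small ?addn0 //; lia.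
  rewrite -(bin_fact kM') -{3}(subnK kM') expnD => E.
  apply/eqP; rewrite -(eqn_pmul2l (pf_gt0 (M %/ p - k %/ p) (k %/ p)
    (k %/ p) (M %/ p - k %/ p))%N); apply/eqP.
  exact: cancel E.
have ltM : (k %/ p < M %/ p)%N by nia.
have [m defm] : exists m, (M %/ p = m.+1)%N 
  by exists (M %/ p).-1; rewrite prednK // (leq_ltn_trans _ ltM).
have km : (k %/ p <= m)%N by rewrite -ltnS -defm.
have -> : ((M - k) %/ p = m - k %/ p)%N.
  have -> : (M - k = (m - k %/ p) * p + (p + M %% p - k %% p))%N by nia.
  by rewrite divnMDl // [X in (_ + X)%N]divn_small ?addn0 //; lia.
rewrite defm /= factS -(bin_fact km) expnS -{3}(subnK km) expnD => E.
apply/eqP; rewrite -(eqn_pmul2l (pf_gt0 (m - k %/ p) (k %/ p)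
  (k %/ p) (m - k %/ p))%N); apply/eqP.
apply: cancel; rewrite E.
move: (p ^ _)%N (p ^ _)%N 'C(m, _) (_`!)%N (_`!)%N => P Q v X Y; ring.
Qed.

Lemma fact_pfreeD x j : (j < p)%N -> fact_pfree p (p * x + j) =
  (fact_pfree p (p * x) * \prod_(i < j) (p * x + i.+1))%N.
Proof.
elim: j => [|j IH] jp; first by rewrite big_ord0 addn0 muln1.
rewrite addnS fact_pfreeS IH ?big_ord_recr /=; last exact: ltnW.
by rewrite -addnS dvdn_addr ?dvdn_mulr // gtnNdvd // mulnA.
Qed.

Lemma fact_pfree_mulS x : fact_pfree p (p * x.+1) =
  (fact_pfree p (p * x) * \prod_(i < p.-1) (p * x + i.+1))%N.
Proof.
have -> : (p * x.+1 = (p * x + p.-1).+1)%N by lia.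
rewrite fact_pfreeS fact_pfreeD; last by lia.
by rewrite -addnS prednK // dvdn_addr ?dvdn_mulr // dvdnn muln1.
Qed.

(** Controls the ratio of consecutive values of [fact_pfree p (p * x)], which is such a product. *)
Lemma prod_affine_flat n (c : nat -> nat) : exists2 g,
  forall M, flat p 1 M g & forall x,
  (\prod_(i < n) (p * x + c i))%N%:Z = (\prod_(i < n) c i)%N%:Z + p%:Z * g x.
Proof.
elim: n => [|n [g gM gE]].
  by exists (fun=> 0) => [M|x]; [apply: flat_cst|rewrite !big_ord0 mulr0].
exists (fun x => (\prod_(i < n) c i)%N%:Z * x%:Z + g x * (p * x + c n)%N%:Z).
  move=> M; apply: flatD; first exact/flatZ/flat_id.
  exact: flatM (gM M) (flat_affine _ _ _).
move=> x; rewrite !big_ord_recr /= !PoszM gE !PoszD PoszM; ring.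
Qed.

(* By Wilson's theorem the sign makes consecutive values congruent mod p. *)
Lemma flat_sign_fact_pfree M :
  flat p 0 M (fun x => (-1) ^+ x * (fact_pfree p (p * x))%:Z).
Proof.
have [g gM gE] := prod_affine_flat p.-1 succn.
have [w wE] : exists w, (p.-1)`!%:Z = p%:Z * w - 1.
  have := p_prime; rewrite Wilson ?prime_gt1 // => /dvdnP[w wE].
  by exists w%:Z; rewrite mulrC -PoszM -wE intS; ring.
elim: M => [//|M IH].
exists (fun x => - (w + g x) * ((-1) ^+ x * (fact_pfree p (p * x))%:Z)).
  apply: (@flatM _ 1 0 _ _ _ _ IH).
  apply: flat_ext (flatZ (-1) (flatD (flat_cst _ _ _ w) (gM M))).
  by move=> x _; rewrite mulN1r.
move=> x _; rewrite fact_pfree_mulS PoszM gE.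
have -> : (\prod_(i < p.-1) i.+1)%N%:Z = p%:Z * w - 1.
  by rewrite -wE fact_prod big_add1 big_mkord.
by rewrite exprS; ring.
Qed.

Lemma flat_sign_fact_pfreeD M j : (j < p)%N ->
  flat p 0 M (fun x => (-1) ^+ x * (fact_pfree p (p * x + j))%:Z).
Proof.
move=> jp; apply: flat_ext (flatM (flat_sign_fact_pfree M) (flat_prod
  (index_enum _) (fun i : 'I_j => flat_affine p M i.+1))) => x _.
rewrite fact_pfreeD // PoszM -mulrA; congr (_ * (_ * _)).
by rewrite (big_morph Posz PoszM (erefl _)).
Qed.

End PFreeFactorial.

(** * Summation over the last digit *)

Lemma PoszX m n : (m ^ n)%N%:Z = m%:Z ^+ n.
Proof. by rewrite -natz natrX natz. Qed.

Lemma dvdz_congr (d a b : int) : (d %| a)%Z -> a = b -> (d %| b)%Z.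
Proof. by move=> + <-. Qed.

Lemma sum_digits (p M : nat) (T : nat -> int) : (0 < p)%N ->
  (forall k, (M < k)%N -> T k = 0) ->
  \sum_(k < M.+1) T k = \sum_(x < (M %/ p).+1) \sum_(a < p) T (p * x + a)%N.
Proof.
move=> p_gt0 T0.
have -> n : \sum_(x < n) \sum_(a < p) T (p * x + a)%N = \sum_(0 <= k < p * n) T k.
  elim: n => [|n IH]; first by rewrite big_ord0 muln0 big_geq.
  rewrite big_ord_recr /= IH mulnS addnC [RHS](@big_cat_nat _ _ _ (p * n)) ?leq_addr //=.
  congr (_ + _); rewrite -{2}[(p * n)%N]addn0 addnC big_addn.
  by rewrite [(_ + p)%N]addnC addnK big_mkord; apply: eq_bigr => i _; rewrite addnC.
have leM : (M.+1 <= p * (M %/ p).+1)%N by rewrite mulnC ltn_ceil.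
rewrite [RHS](@big_cat_nat _ _ _ M.+1) //= -(big_mkord xpredT) -[LHS]addr0.
congr (_ + _); symmetry; rewrite big_nat_cond big1 // => k /andP[/andP[Mk _] _].
exact: T0.
Qed.

(* Modulo p ^ Q this is (fact_pfree M / (fact_pfree k * fact_pfree (M - k))) ^ r,
   the inverse being taken by Euler's theorem. *)
Definition bin_unit (p r Q M k : nat) : nat :=
  ((fact_pfree p M *
    (fact_pfree p k * fact_pfree p (M - k)) ^ (totient (p ^ Q)).-1) ^ r)%N.

(** [P] selects terms by whether [p] divides the binomial: [xpredT] keeps all, [id] the multiples of
    [p], [negb] the units. The sign [eps] is -1 for odd [p] and can be taken to be 1 for the odd
    terms when [p] is 2. *)
Definition psum (p r : nat) (eps : int) (P : bool -> bool) (M : nat)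
    (g : nat -> int) : int :=
  \sum_(k < M.+1 | P (p %| 'C(M, k))%N) eps ^+ k * 'C(M, k)%:Z ^+ r * g k.

(** The weight that replaces [g] on the quotient [M %/ p], from last digits without borrow;
    [high_digit_sum] collects the digits that borrow and is a weight on [(M %/ p).-1]. *)
Definition low_digit_sum (p r Q : nat) (eps : int) (M : nat) (g : nat -> int) x :=
  \sum_(a < (M %% p).+1)
    eps ^+ a * ((bin_unit p r Q M (p * x + a))%:Z * g (p * x + a)%N).

Definition high_digit_sum (p r Q : nat) (eps : int) (M : nat) (g : nat -> int) x :=
  \sum_(a < p - (M %% p).+1)
    eps ^+ ((M %% p).+1 + a) *
    ((bin_unit p r Q M (p * x + ((M %% p).+1 + a)))%:Z *
     g (p * x + ((M %% p).+1 + a))%N).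

Section Step.

Variables (p r Q : nat) (eps : int).
Hypotheses (p_prime : prime p) (r_gt0 : (0 < r)%N) (eps_p : eps ^+ p = eps).

Let p_gt0 : (0 < p)%N := prime_gt0 p_prime.

Lemma bin_unitP M k : (k <= M)%N ->
  ((p ^ Q)%N %| 'C(M, k)%:Z ^+ r -
    (if k %% p <= M %% p then 'C(M %/ p, k %/ p)
     else p * (M %/ p) * 'C((M %/ p).-1, k %/ p))%N%:Z ^+ r *
    (bin_unit p r Q M k)%:Z)%Z.
Proof.
move=> kM; have := bin_pfree p_prime kM; rewrite /bin_unit.
set D := (fact_pfree p k * _)%N; set N := fact_pfree p M.
set B := (if _ then _ else _) => E.
have copD : coprime D (p ^ Q).
  by rewrite coprime_sym coprimeXl // coprimeMr !coprime_fact_pfree.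
rewrite -!PoszX -PoszM -eqz_mod_dvd !modz_nat eqz_nat.
rewrite -expnMn -modnXm -[X in _ == X]modnXm; apply/eqP; congr ((_ ^ _) %% _)%N.
rewrite mulnA -E -mulnA -expnS prednK ?totient_gt0 ?expn_gt0 ?p_gt0 //.
by rewrite -modnMmr Euler_exp_totient // modnMmr muln1.
Qed.

(** The factorials in [bin_pfree] are prime to [p], so the remaining factor decides; after a borrow
    it contains [p]. This is one digit of Kummer's criterion. *)
Lemma dvdn_bin_digits M k : (k <= M)%N ->
  (p %| 'C(M, k))%N = (k %% p <= M %% p)%N ==> (p %| 'C(M %/ p, k %/ p))%N.
Proof.
move=> kM; have := bin_pfree p_prime kM.
have cop n : coprime p (fact_pfree p n) := coprime_fact_pfree p_prime n.
move=> /(congr1 (dvdn p)); rewrite !Gauss_dvdl ?coprimeMr ?cop // => ->.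
by case: ifP => //= _; rewrite -mulnA dvdn_mulr.
Qed.

(** Write [k = p * x + a]. The sign splits because [eps ^+ p = eps], and the power of the binomial
    splits by [bin_unitP]. For low digits [P] passes to the quotient binomial; for high digits it is
    constantly [P true]. *)
Lemma psum_step P M g : ((p ^ Q)%N %| psum p r eps P M g -
  (psum p r eps P (M %/ p) (low_digit_sum p r Q eps M g) +
   (P true)%:R * (p * (M %/ p))%N%:Z ^+ r *
    psum p r eps xpredT (M %/ p).-1 (high_digit_sum p r Q eps M g)))%Z.
Proof.
set M' := (M %/ p)%N; set M0 := (M %% p)%N.
have M0p : (M0 < p)%N by rewrite ltn_mod.
have defM : M = (p * M' + M0)%N by rewrite mulnC -divn_eq.
pose T k := if P (p %| 'C(M, k))%N then eps ^+ k * 'C(M, k)%:Z ^+ r * g k else 0.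
have T0 k : (M < k)%N -> T k = 0.
  by move=> Mk; rewrite /T bin_small // expr0n gtn_eqF // mulr0 mul0r if_same.
have digit x a : (a < p)%N -> ((p * x + a) %/ p = x /\ (p * x + a) %% p = a)%N.
  by move=> ap; rewrite mulnC divnMDl // modnMDl divn_small // modn_small // addn0.
have eps_digit x a : eps ^+ (p * x + a) = eps ^+ x * eps ^+ a.
  by rewrite exprD exprM eps_p.
have -> : psum p r eps P M g = \sum_(x < M'.+1) \sum_(a < M0.+1) T (p * x + a)%N +
    \sum_(x < M') \sum_(a < p - M0.+1) T (p * x + (M0.+1 + a))%N.
  rewrite /psum big_mkcond (sum_digits p_gt0 T0) -/M'.
  have split x : \sum_(a < p) T (p * x + a)%N = \sum_(a < M0.+1) T (p * x + a)%N +
      \sum_(a < p - M0.+1) T (p * x + (M0.+1 + a))%N.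
    rewrite -(big_mkord xpredT (fun a => T (p * x + a)%N)).
    rewrite (@big_cat_nat _ _ _ M0.+1) //= big_mkord; congr (_ + _).
    rewrite -{1}[M0.+1]add0n big_addn big_mkord.
    by apply: eq_bigr => i _; rewrite [(i + _)%N]addnC.
  under eq_bigr do rewrite split.
  rewrite big_split /=; congr (_ + _).
  rewrite big_ord_recr /= [X in _ + X]big1 ?addr0 // => i _.
  by apply: T0; rewrite defM; lia.
rewrite opprD addrACA; apply: rpredD.
  rewrite /psum [X in _ - X]big_mkcond /= -sumrB; apply: rpred_sum => x _.
  set b := P _; have -> : \sum_(a < M0.+1) T (p * x + a)%N = if b then
      \sum_(a < M0.+1) eps ^+ (p * x + a) * 'C(M, p * x + a)%:Z ^+ r * g (p * x + a)%N
      else 0.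
    have [xM' aM0] := (ltn_ord x, fun a : 'I_M0.+1 => ltn_ord a).
    transitivity (\sum_(a < M0.+1) (if b then eps ^+ (p * x + a) *
      'C(M, p * x + a)%:Z ^+ r * g (p * x + a)%N else 0)).
      apply: eq_bigr => a _; rewrite /T dvdn_bin_digits; last by have := aM0 a; nia.
      have [|-> ->] := digit x a; first by have := aM0 a; lia.
      by rewrite -/M0 -ltnS aM0.
    by case: b => //; rewrite big1.
  case: b; last by rewrite subrr rpred0.
  rewrite mulr_sumr -sumrB; apply: rpred_sum => a _.
  have [|dE mE] := digit x a; first by have := ltn_ord a; lia.
  have kM : (p * x + a <= M)%N by have := ltn_ord a; have := ltn_ord x; nia.
  have := bin_unitP kM; rewrite dE mE -/M0 -/M' -[(a <= M0)%N]ltnS ltn_ord.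
  move=> /(dvdz_mull (eps ^+ (p * x + a) * g (p * x + a)%N)) dvd.
  by apply: dvdz_congr dvd _; rewrite eps_digit; ring.
(* If [M'] is 0, the right-hand sum still has a term because [0.-1] is 0; the factor [(p * 0) ^+ r]
   kills it. *)
have [M'0|M'_gt0] := posnP M'.
  by rewrite M'0 big_ord0 muln0 expr0n gtn_eqF // mulr0 mul0r subrr rpred0.
rewrite /psum prednK // mulr_sumr -sumrB; apply: rpred_sum => x _.
rewrite /high_digit_sum !mulr_sumr -sumrB; apply: rpred_sum => a _.
have ap : (M0.+1 + a < p)%N by have := ltn_ord a; lia.
have kM : (p * x + (M0.+1 + a) <= M)%N by have := ltn_ord x; nia.
have [dE mE] := digit x _ ap.
rewrite /T dvdn_bin_digits // mE -/M0 leqNgt ltn_addr //=.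
case: (P true); last by rewrite !mul0r subrr rpred0.
have := bin_unitP kM; rewrite dE mE -/M0 -/M' leqNgt ltn_addr //=.
move=> /(dvdz_mull (eps ^+ (p * x + (M0.+1 + a)) * g (p * x + (M0.+1 + a))%N)) dvd.
by apply: dvdz_congr dvd _; rewrite eps_digit !PoszM !exprMn mul1r; ring.
Qed.

End Step.

(** * Symmetry and flatness of the digit sums *)

Lemma bin_unit_sym p r Q M k : (k <= M)%N ->
  bin_unit p r Q M (M - k) = bin_unit p r Q M k.
Proof. by move=> kM; rewrite /bin_unit subKn // (mulnC (fact_pfree p (M - k))). Qed.

(** The factorials are flat only up to sign, but the signs attached to [k] and [M - k] multiply to
    the constant [(-1) ^+ N]. The digit [b] is the last one of [M - k], so both the case with and
    the case without borrow are covered. *)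
Lemma flat_bin_unit p r Q M N a b : prime p -> (a < p)%N -> (b < p)%N ->
  M = (p * N + (a + b))%N ->
  flat p 0 N (fun x => (bin_unit p r Q M (p * x + a))%:Z).
Proof.
move=> p_prime ap bp defM.
have := flatM (flat_sign_fact_pfreeD p_prime N ap)
  (flat_rev (flat_sign_fact_pfreeD p_prime N bp)).
move=> /(flatZ ((-1) ^+ N)) /(flatX (totient (p ^ Q)).-1).
move=> /(flatZ (fact_pfree p M)%:Z) /(flatX r); apply: flat_ext => x xN.
rewrite /bin_unit PoszX PoszM PoszX PoszM; congr ((_ * _ ^+ _) ^+ _).
have -> : (M - (p * x + a) = p * (N - x) + b)%N by nia.
have sgn : (-1) ^+ N * ((-1) ^+ x * (-1) ^+ (N - x)) = 1%R :> int.
  by rewrite -exprD subnKC // -exprD -signr_odd oddD addbb.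
by rewrite -[RHS]mul1r -[X in _ = X * _]sgn; ring.
Qed.

Lemma low_digit_sum_sym p r Q eps M g : eps ^+ p = eps -> eps ^+ 2 = 1 ->
  (forall k, (k <= M)%N -> g (M - k)%N = eps ^+ M * g k) ->
  forall x, (x <= M %/ p)%N -> low_digit_sum p r Q eps M g (M %/ p - x)%N =
    eps ^+ (M %/ p) * low_digit_sum p r Q eps M g x.
Proof.
move=> eps_p eps_2 gM x xM; rewrite /low_digit_sum (reindex_inj rev_ord_inj) /=.
rewrite mulr_sumr; apply: eq_bigr => -[a /= aM] _; rewrite subSS; move: aM xM.
have defM : M = (p * (M %/ p) + M %% p)%N by rewrite mulnC -divn_eq.
move: defM; set N := (M %/ p)%N; set M0 := (M %% p)%N; rewrite ltnS => defM aM xM.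
have pxM := leq_mul (leqnn p) xM.
have kM : (p * x + a <= M)%N by lia.
have -> : (p * (N - x) + (M0 - a) = M - (p * x + a))%N by rewrite mulnBr; lia.
rewrite gM // bin_unit_sym //.
have -> : eps ^+ M = eps ^+ N * eps ^+ M0 by rewrite {1}defM exprD exprM eps_p.
have eps_sq n : eps ^+ n * eps ^+ n = 1.
  by rewrite -exprMn -expr2 eps_2 expr1n.
have -> : eps ^+ (M0 - a) = eps ^+ M0 * eps ^+ a.
  by rewrite -{2}(subnK aM) exprD -mulrA eps_sq mulr1.
move: (eps_sq M0); move: (eps ^+ M0) (eps ^+ N) (eps ^+ a) => e0 e1 e2 e0_sq.
rewrite -[RHS]mul1r -[X in _ = X * _]e0_sq; ring.
Qed.

(** After a borrow, [k -> M - k] sends the last digit [b] to [p + M %% p - b] and the quotient [x]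
    to [(M %/ p).-1 - x]. *)
Lemma high_digit_sum_sym p r Q eps M g : (0 < p)%N ->
  eps ^+ p = eps -> eps ^+ 2 = 1 ->
  (forall k, (k <= M)%N -> g (M - k)%N = eps ^+ M * g k) ->
  forall x, (x <= (M %/ p).-1)%N ->
    high_digit_sum p r Q eps M g ((M %/ p).-1 - x)%N =
    eps ^+ (M %/ p).-1 * high_digit_sum p r Q eps M g x.
Proof.
move=> p_gt0 eps_p eps_2 gM x xM.
have [M'0|M'_gt0] := posnP (M %/ p).
  by move: xM; rewrite M'0 leqn0 => /eqP ->; rewrite mul1r.
rewrite /high_digit_sum (reindex_inj rev_ord_inj) /=.
rewrite mulr_sumr; apply: eq_bigr => -[a /= lt_a] _.
have ltM : (M %% p < p)%N by rewrite ltn_mod.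
have defM : M = (p * (M %/ p) + M %% p)%N by rewrite mulnC -divn_eq.
move: xM M'_gt0 defM ltM lt_a.
set N := (M %/ p)%N; set M0 := (M %% p)%N => xM M'_gt0 defM ltM lt_a.
have pxM := leq_mul (leqnn p) xM.
have pN : (p * N = p * N.-1 + p)%N by rewrite -mulnSr prednK.
have kM : (p * x + (M0.+1 + a) <= M)%N by lia.
have -> : (M0.+1 + (p - M0.+1 - a.+1) = p + M0 - (M0.+1 + a))%N by lia.
set b := (M0.+1 + a)%N; have b_le : (b <= p + M0)%N by lia.
have -> : (p * (N.-1 - x) + (p + M0 - b) = M - (p * x + b))%N.
  by rewrite mulnBr; lia.
rewrite gM // bin_unit_sym //.
have eps_sq n : eps ^+ n * eps ^+ n = 1.
  by rewrite -exprMn -expr2 eps_2 expr1n.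
have -> : eps ^+ M = eps ^+ N.-1 * eps * eps ^+ M0.
  by rewrite -exprSr prednK // {1}defM exprD exprM eps_p.
have -> : eps ^+ (p + M0 - b) = eps * eps ^+ M0 * eps ^+ b.
  have -> : eps * eps ^+ M0 = eps ^+ (p + M0) by rewrite exprD eps_p.
  by rewrite -{2}(subnK b_le) exprD -mulrA eps_sq mulr1.
move: (eps_sq M0) (eps_sq 1%N).
move: (eps ^+ M0) (eps ^+ N.-1) (eps ^+ b) => e0 e1 e2 e0_sq; rewrite expr1 => e_sq.
rewrite -[RHS]mul1r -[X in _ = X * _]e0_sq -[RHS]mul1r -[X in _ = X * _]e_sq; ring.
Qed.

(** Decimation costs two units of index; [flat_antisym_divp] restores them before the next digit. *)
Lemma flat_low_digit_sum p r Q eps M g : prime p -> odd p -> flat p 2 M g ->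
  flat p 0 (M %/ p) (low_digit_sum p r Q eps M g).
Proof.
move=> p_prime p_odd gM; apply: flat_sum => -[a /= lt_a] _; apply: flatZ.
have ltM : (M %% p < p)%N by rewrite ltn_mod prime_gt0.
have defM : M = (p * (M %/ p) + M %% p)%N by rewrite mulnC -divn_eq.
apply: (@flatM _ 0 0).
  by apply: (@flat_bin_unit _ _ _ _ _ _ (M %% p - a)) => //; lia.
apply: flat_decimate20 gM; rewrite ?prime_gt1 //.
by rewrite [X in (_ <= X)%N]defM leq_add2l -ltnS.
Qed.

Lemma flat_high_digit_sum p r Q eps M g : prime p -> odd p -> flat p 2 M g ->
  flat p 0 (M %/ p).-1 (high_digit_sum p r Q eps M g).
Proof.
move=> p_prime p_odd gM; have [->//|M'_gt0] := posnP (M %/ p).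
apply: flat_sum => -[a /= lt_a] _; apply: flatZ.
have ltM : (M %% p < p)%N by rewrite ltn_mod prime_gt0.
have defM : M = (p * (M %/ p).-1 + p + M %% p)%N.
  by rewrite -mulnSr prednK // mulnC -divn_eq.
apply: (@flatM _ 0 0).
  by apply: (@flat_bin_unit _ _ _ _ _ _ (p + M %% p - ((M %% p).+1 + a))) => //; lia.
apply: flat_decimate20 gM; rewrite ?prime_gt1 //.
by lia.
Qed.

Lemma flat_modp p M f x : flat p 0 M f -> (x <= M)%N -> (p%:Z %| f x - f 0%N)%Z.
Proof.
elim: x => [|x IH] fM xM; first by rewrite subrr dvdz0.
case: M fM IH xM => [//|M] fM IH xM; have [g _ gE] := fM.
have -> : f x.+1 - f 0%N = p%:Z * g x + (f x - f 0%N) by rewrite -gE //; ring.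
by apply: rpredD; [apply: dvdz_mulr|apply: IH => //; lia].
Qed.

(** * Odd quotients and Legendre's formula *)

Definition odd_quotients (p M : nat) : nat := (\sum_(i < M) odd (M %/ p ^ i))%N.

Section OddQuotients.

Variable p : nat.
Hypothesis p_prime : prime p.

Let p_gt1 : (1 < p)%N := prime_gt1 p_prime.

(** Indices [i >= M] contribute nothing, since then [p ^ i > M]. *)
Lemma odd_quotientsE M n : (M <= n)%N ->
  odd_quotients p M = (\sum_(0 <= i < n) odd (M %/ p ^ i))%N.
Proof.
move=> Mn; rewrite (@big_cat_nat _ _ _ M) //= big_mkord.
rewrite [X in (_ + X)%N]big_nat_cond [X in (_ + X)%N]big1 ?addn0 //.
move=> i /andP[/andP[Mi _] _].
by rewrite divn_small // (leq_ltn_trans Mi) // ltn_expl.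
Qed.

Lemma odd_quotients_rec M : (0 < M)%N ->
  odd_quotients p M = (odd M + odd_quotients p (M %/ p))%N.
Proof.
move=> M_gt0; rewrite (@odd_quotientsE _ M.+1) // big_nat_recl //= divn1.
rewrite (@odd_quotientsE _ M) ?leq_div //; congr (_ + _)%N.
by apply: eq_bigr => i _; rewrite expnS divnMA.
Qed.

(** The quotients of [M] and [M.-1] by [p ^ i] differ only when [p ^ i] divides [M], that is for
    [(logn p M).+1] values of [i]. *)
Lemma odd_quotients_pred M : (0 < M)%N ->
  (odd_quotients p M <= odd_quotients p M.-1 + (logn p M).+1)%N.
Proof.
elim/ltn_ind: M => -[//|M] IH _; rewrite odd_quotients_rec //=.
have p_gt0 := ltnW p_gt1.
have recM : (odd_quotients p (M %/ p) <= odd_quotients p M)%N.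
  case: (M) => [|m]; first by rewrite div0n.
  by rewrite [X in (_ <= X)%N]odd_quotients_rec // leq_addl.
rewrite divnS //; have [dvd|ndvd] := boolP (p %| M.+1)%N; last first.
  by rewrite add0n; have := leq_b1 (~~ odd M); lia.
have dvdE : (M.+1 %/ p = (M %/ p).+1)%N by rewrite divnS // dvd.
have := IH (M %/ p).+1; rewrite -{1}dvdE ltn_Pdiv // => /(_ isT isT).
have -> : logn p M.+1 = (logn p (M %/ p).+1).+1 by rewrite lognE p_prime dvd dvdE.
by rewrite /= add1n; have := leq_b1 (~~ odd M); lia.
Qed.

(** In Legendre's formula the [k]-th contribution is [2n %/ p ^ k] minus twice its half, hence its
    parity; the index 0 adds nothing as [2n] is even. *)
Lemma logn_central_bin n : logn p 'C(2 * n, n) = odd_quotients p (2 * n).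
Proof.
have le_n : (n <= 2 * n)%N by lia.
have := congr1 (logn p) (bin_fact le_n).
have -> : (2 * n - n = n)%N by lia.
rewrite !lognM ?muln_gt0 ?fact_gt0 ?bin_gt0 // !logn_fact //.
have -> : (\sum_(1 <= k < n.+1) n %/ p ^ k = \sum_(1 <= k < (2 * n).+1) n %/ p ^ k)%N.
  rewrite [RHS](@big_cat_nat _ _ _ n.+1) //= [X in (_ + X)%N]big_nat_cond.
  rewrite [X in (_ + X)%N]big1 ?addn0 // => i /andP[/andP[ni _] _].
  by rewrite divn_small // (ltn_trans ni) // ltn_expl.
have -> : (\sum_(1 <= k < (2 * n).+1) (2 * n) %/ p ^ k =
    odd_quotients p (2 * n) + \sum_(1 <= k < (2 * n).+1) n %/ p ^ k +
    \sum_(1 <= k < (2 * n).+1) n %/ p ^ k)%N.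
  have -> : (odd_quotients p (2 * n) =
      \sum_(1 <= k < (2 * n).+1) odd ((2 * n) %/ p ^ k))%N.
    by rewrite (@odd_quotientsE _ (2 * n).+1) // big_ltn // divn1 oddM.
  rewrite -!big_split mul2n /=; apply: eq_bigr => k _.
  have -> : (n %/ p ^ k = (n.*2 %/ p ^ k)./2)%N.
    by rewrite -divn2 -divnMA mulnC divnMA -muln2 mulnK.
  by rewrite -addnA addnn odd_double_half.
lia.
Qed.

End OddQuotients.

(** * Divisibility of the sums for odd primes *)

Lemma psum_ext p r eps P M f g : (forall k, (k <= M)%N -> f k = g k) ->
  psum p r eps P M f = psum p r eps P M g.
Proof. by move=> fg; apply: eq_bigr => k _; rewrite fg // -ltnS. Qed.

Lemma psumZ p r eps P M c g :
  psum p r eps P M (fun k => c * g k) = c * psum p r eps P M g.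
Proof. by rewrite /psum mulr_sumr; apply: eq_bigr => k _; rewrite mulrCA. Qed.

(* An antisymmetric flat function is a multiple of p: this is the source of each
   factor p. *)
Lemma flat_antisym_divp p M g : prime p -> odd p -> flat p 0 M g ->
  (forall k, (k <= M)%N -> g (M - k)%N = (-1) ^+ M * g k) ->
  exists2 h, flat p 2 M h & (forall k, (k <= M)%N -> g k = p%:Z ^+ odd M * h k) /\
    (forall k, (k <= M)%N -> h (M - k)%N = (-1) ^+ M * h k).
Proof.
move=> p_prime p_odd gM gS; have [M_odd|M_even] := boolP (odd M); last first.
  exists g; first exact/flat_succ/flat_succ.
  by split=> // k _; rewrite expr0 mul1r.
have dvd_g k : (k <= M)%N -> (p%:Z %| g k)%Z.
  move=> kM; have : (p%:Z %| 2%:Z * g k)%Z.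
    (* Here [g (M - k) = - g k], and by flatness both values are congruent to [g 0] mod [p]. *)
    have -> : 2%:Z * g k = (g k - g 0%N) - (g (M - k)%N - g 0%N).
      by rewrite gS // -signr_odd M_odd expr1 (_ : 2%:Z = 2) //; ring.
    by apply: rpredB; apply: (flat_modp gM); rewrite ?leq_subr.
  by rewrite Gauss_dvdzr // coprimezE /= coprimen2.
have p_neq0 : p%:Z != 0 by rewrite eqz_nat -lt0n prime_gt0.
have gE k : (k <= M)%N -> g k = p%:Z * (g k %/ p%:Z)%Z.
  by move=> kM; rewrite mulrC divzK ?dvd_g.
exists (fun k => g k %/ p%:Z)%Z.
  by apply: flat_divp; rewrite ?prime_gt0 //; apply: flat_ext gM.
split=> k kM; first by rewrite expr1; apply: gE.
apply: (mulfI p_neq0); rewrite mulrCA -!gE ?leq_subr //; exact: gS.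
Qed.

(** Each level extracts [p ^ odd M] from the weight and then applies [psum_step]. Along the low
    digits the extra [p] for a [P] rejecting units comes from [M = 0], where the only binomial is 1
    and the sum is empty. *)
Lemma dvd_psum p r P M g : prime p -> odd p -> (1 < r)%N -> flat p 0 M g ->
  (forall k, (k <= M)%N -> g (M - k)%N = (-1) ^+ M * g k) ->
  ((p ^ (odd_quotients p M + ~~ P false))%N%:Z %| psum p r (-1) P M g)%Z.
Proof.
move=> p_prime p_odd r_gt1.
elim/ltn_ind: M P g => M IH P g gM gS.
have [M0|M_gt0] := posnP M.
  rewrite M0 /odd_quotients big_ord0; case PF: (P false) => /=.
    by rewrite expn0 dvd1z.
  rewrite /psum big_mkcond big_ord1 /= bin0 dvdn1.
  by rewrite gtn_eqF ?prime_gt1 // PF dvdz0.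
have r_gt0 : (0 < r)%N by lia.
have p_gt1 := prime_gt1 p_prime.
have eps_p : (-1) ^+ p = -1 :> int by rewrite -signr_odd p_odd expr1.
have eps_2 : (-1) ^+ 2 = 1%R :> int by rewrite sqrrN expr1n.
have [h hM [gE hS]] := flat_antisym_divp p_prime p_odd gM gS.
rewrite (psum_ext _ _ _ _ gE) psumZ odd_quotients_rec // -addnA expnD PoszM PoszX.
apply: dvdz_mul; first exact: dvdzz.
set v := (odd_quotients p (M %/ p) + _)%N.
have v_le : (v <= (odd_quotients p (M %/ p)).+1)%N.
  by rewrite /v -addn1 leq_add2l leq_b1.
have M'M : (M %/ p < M)%N by apply: ltn_Pdiv.
rewrite -[psum _ _ _ _ _ _](subrK (psum p r (-1) P (M %/ p)
    (low_digit_sum p r v (-1) M h) + (P true)%:R * (p * (M %/ p))%N%:Z ^+ r *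
    psum p r (-1) xpredT (M %/ p).-1 (high_digit_sum p r v (-1) M h))).
apply: rpredD; first exact: psum_step.
apply: rpredD.
  apply: IH => //; first exact: flat_low_digit_sum.
  exact: low_digit_sum_sym.
have [M'0|M'_gt0] := posnP (M %/ p).
  by rewrite M'0 muln0 expr0n gtn_eqF // mulr0 mul0r rpred0.
rewrite -mulrA; apply: dvdz_mull.
have dvd_high : ((p ^ odd_quotients p (M %/ p).-1)%N%:Z %|
    psum p r (-1) xpredT (M %/ p).-1 (high_digit_sum p r v (-1) M h))%Z.
  have := IH (M %/ p).-1 _ xpredT (high_digit_sum p r v (-1) M h).
  rewrite addn0; apply; first by lia.
    exact: flat_high_digit_sum.
  by apply: high_digit_sum_sym => //; lia.
have dvd_pM : ((p ^ ((logn p (M %/ p)).+1 * r))%N%:Z %| (p * (M %/ p))%N%:Z ^+ r)%Z.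
  rewrite expnM PoszX; apply: dvdz_exp2r; rewrite expnS !PoszM.
  by apply: dvdz_mul => //; rewrite dvdzE /= pfactor_dvdnn.
apply: dvdz_trans (dvdz_mul dvd_pM dvd_high).
rewrite -PoszM -expnD dvdzE /= dvdn_exp2l // (leq_trans v_le) //.
(* With [e = logn p (M %/ p)], passing to the predecessor loses at most [e.+1] odd quotients, while
   [e.+1 * r >= e.+2] because [r >= 2]; this leaves the one extra [p]. *)
have := odd_quotients_pred p_prime M'_gt0; nia.
Qed.

(** * The alternating sum of squares *)

Lemma coef_expr_1DZX (c : int) m k :
  ((1 + c *: 'X) ^+ m : {poly int})`_k = c ^+ k * 'C(m, k)%:Z.
Proof.
rewrite exprDn.
have -> : \sum_(i < m.+1) (1 ^+ (m - i) * (c *: 'X) ^+ i) *+ 'C(m, i) =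
    \poly_(i < m.+1) (c ^+ i * 'C(m, i)%:Z).
  rewrite poly_def; apply: eq_bigr => i _.
  by rewrite expr1n mul1r exprZn scalerMnl -mulr_natr natz.
rewrite coef_poly ltnS; case: leqP => // mk.
by rewrite bin_small // mulr0.
Qed.

(** Compare the coefficients of [X^(2n)] in [(1 - X)^(2n) (1 + X)^(2n) = (1 - X^2)^(2n)]. *)
Lemma sum_sqr_bin_alternating n :
  \sum_(k < (2 * n).+1) (-1) ^+ k * 'C(2 * n, k)%:Z ^+ 2 =
  (-1) ^+ n * 'C(2 * n, n)%:Z.
Proof.
have E : (1 + (-1) *: 'X) ^+ (2 * n) * (1 + 1 *: 'X) ^+ (2 * n) =
    (1 + (-1) *: 'X) ^+ (2 * n) \Po 'X^2 :> {poly int}.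
  rewrite -exprMn [RHS]rmorphXn /=; congr (_ ^+ _).
  rewrite comp_polyD rmorph1 comp_polyZ comp_polyX !scaleN1r scale1r.
  by rewrite -subr_sqr expr1n.
have := congr1 (fun q : {poly int} => q`_(2 * n)) E.
rewrite coefM coef_comp_poly_Xn // dvdn_mulr // mulKn // coef_expr_1DZX => <-.
apply: eq_bigr => k _; rewrite !coef_expr_1DZX expr1n mul1r bin_sub; last first.
  by rewrite -ltnS.
by rewrite expr2 mulrA.
Qed.

(** * The prime 2 *)

(** The smoothness used for the prime 2: [flat_decimate20] needs an odd prime, and differences
    divisible by 4 leave room for halving a symmetrized weight. *)
Definition quartic_diff (c M : nat) (f : nat -> int) : Prop :=
  exists2 h, flat 2 c M.-1 h
    & forall x, (x < M)%N -> f x.+1 - f x = 4%:Z * h x.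

Section Two.

Local Notation qdiff := quartic_diff.

Lemma qdiff_ext c M f g : (forall x, (x <= M)%N -> f x = g x) ->
  qdiff c M f -> qdiff c M g.
Proof.
move=> fg [h hM hE]; exists h => // x xM.
by rewrite -!fg ?hE // ltnW.
Qed.

Lemma qdiff_succ c M f : qdiff c M f -> qdiff c.+1 M f.
Proof. by move=> [h hM hE]; exists h => //; apply: flat_succ. Qed.

Lemma qdiff_flat M f : qdiff 0 M f -> flat 2 0 M f.
Proof.
case: M => [//|M] [h hM hE]; exists (fun x => 2%:Z * h x).
  exact/flatZ/flat_succ.
by move=> x xM; rewrite hE // mulrA.
Qed.

Lemma qdiff_cst M a : qdiff 0 M (fun=> a).
Proof.
by exists (fun=> 0); [apply: flat_cst|move=> x _; rewrite subrr mulr0].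
Qed.

Lemma qdiffM M f g : qdiff 0 M f -> qdiff 0 M g -> qdiff 0 M (fun x => f x * g x).
Proof.
case: M => [|M]; first by exists (fun=> 0).
move=> fM gM; have [[f1 f1M fE] [g1 g1M gE]] := (fM, gM).
exists (fun x => f x.+1 * g1 x + f1 x * g x).
  apply: flatD; first exact: (@flatM _ 0 0 _ _ _ (flatS (qdiff_flat fM)) g1M).
  exact: (@flatM _ 0 0 _ _ _ f1M (flatW (qdiff_flat gM))).
move=> x xM; rewrite mulrDr mulrCA -gE // mulrA -fE //; ring.
Qed.

Lemma qdiffX M f n : qdiff 0 M f -> qdiff 0 M (fun x => f x ^+ n).
Proof.
move=> fM; elim: n => [|n IH]; first exact: qdiff_cst.
by apply: qdiff_ext (qdiffM fM IH) => x _; rewrite exprS.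
Qed.

Lemma qdiff_rev c M f : qdiff c M f -> qdiff c M (fun x => f (M - x)%N).
Proof.
move=> [h hM hE]; exists (fun x => -1 * h (M.-1 - x)%N).
  exact/flatZ/flat_rev.
move=> x xM; have -> : (M - x = (M.-1 - x).+1)%N by lia.
have -> : (M - x.+1 = M.-1 - x)%N by lia.
by rewrite mulrCA -hE ?mulN1r ?opprB //; lia.
Qed.

(* The square of 2 * x + 1 is 1 + 4 * x * (x + 1), and x * (x + 1) is even. *)
Lemma qdiff_sqr_fact_pfree M j : (j < 2)%N ->
  qdiff 0 M (fun x => (fact_pfree 2 (2 * x + j))%:Z ^+ 2).
Proof.
have two_prime : prime 2 by [].
have pf0 : qdiff 0 M (fun x => (fact_pfree 2 (2 * x))%:Z ^+ 2).
  exists (fun x => (x%:Z * x.+1%:Z) * (fact_pfree 2 (2 * x))%:Z ^+ 2).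
    apply: (@flatM _ 0 0).
      case: M.-1 => [//|N]; exists (fun x => x%:Z + 1).
        exact: flatD (flat_id _ _) (flat_cst _ _ _ _).
      by move=> x _; rewrite !intS; ring.
    apply: flat_ext (flatX 2 (flat_sign_fact_pfree two_prime M.-1)) => x _.
    by rewrite exprMn -exprM mulnC exprM sqrrN !expr1n mul1r.
  move=> x _; rewrite fact_pfree_mulS // big_ord1 /= !PoszM PoszD PoszM [x.+1%:Z]intS.
  by ring.
case: j => [_|[_|//]].
  by apply: qdiff_ext pf0 => x _; rewrite addn0.
have aff : qdiff 0 M (fun x => (2 * x + 1)%N%:Z ^+ 2).
  exists (fun x => (2 * x + 2)%N%:Z); first exact: flat_affine.
  move=> x _; rewrite !PoszD !PoszM [x.+1%:Z]intS.
  by ring.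
apply: qdiff_ext (qdiffM pf0 aff) => x _.
by rewrite fact_pfreeD // big_ord1 PoszM exprMn.
Qed.

(** The even exponent [2 * s] turns the factorials into squares, to which [qdiff_sqr_fact_pfree]
    applies. *)
Lemma qdiff_bin_unit s Q M N a b : (a < 2)%N -> (b < 2)%N ->
  M = (2 * N + (a + b))%N ->
  qdiff 0 N (fun x => (bin_unit 2 (2 * s) Q M (2 * x + a))%:Z).
Proof.
move=> a2 b2 defM.
have := qdiffM (qdiff_sqr_fact_pfree N a2) (qdiff_rev (qdiff_sqr_fact_pfree N b2)).
move=> /(qdiffX (totient (2 ^ Q)).-1).
move=> /(qdiffM (qdiff_cst N ((fact_pfree 2 M)%:Z ^+ 2))) /(qdiffX s).
apply: qdiff_ext => x xN.
rewrite /bin_unit (_ : M - (2 * x + a) = 2 * (N - x) + b)%N; last by lia.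
rewrite PoszX PoszM PoszX PoszM exprM; congr (_ ^+ _).
rewrite [RHS]exprMn; congr (_ * _).
rewrite -[X in X ^+ _ = _]exprMn -!exprM; congr (_ ^+ _).
exact: mulnC.
Qed.

Lemma qdiff_decimate M N a g : (2 * N + a <= M)%N -> qdiff 2 M g ->
  qdiff 0 N (fun x => g (2 * x + a)%N).
Proof.
case: N => [|N] leM [h hM hE]; first by exists (fun=> 0).
exists (fun x => h (2 * x + a)%N + h (2 * x + a).+1); last first.
  move=> x xN; have -> : (2 * x.+1 + a = (2 * x + a).+2)%N by lia.
  by rewrite mulrDr -!hE ?addrA; [ring|lia|lia].
apply: (@flat_decimate10 2 M.-2 _ _ (fun y => h y + h y.+1)) => //=; first by lia.
have [m defm] : exists m, M.-1 = m.+1 by exists M.-2; lia.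
rewrite defm in hM; rewrite (_ : M.-2 = m) ?defm //.
(* [h y + h y.+1] is [2 * h y] plus the difference of [h], and both have index 1. *)
apply: flat_ext (flatD (flat_succ (flat_mulp (flatW hM))) hM) => x _.
by ring.
Qed.

Lemma qdiff_mod4 c M f x : qdiff c M f -> (x <= M)%N -> (4%:Z %| f x - f 0%N)%Z.
Proof.
move=> [h _ hE]; elim: x => [|x IH] xM; first by rewrite subrr dvdz0.
have -> : f x.+1 - f 0%N = 4%:Z * h x + (f x - f 0%N) by rewrite -hE //; ring.
by apply: rpredD; [apply: dvdz_mulr|apply: IH; lia].
Qed.

(** Twice the difference of [s] is [4 * (h x - h (M.-1 - x))]. The bracket is even because [h] is
    constant mod 2, and halving it raises its index from 0 to 2. *)
Lemma qdiff_average M f s : qdiff 0 M f ->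
  (forall x, (x <= M)%N -> 2%:Z * s x = f x + f (M - x)%N) -> qdiff 2 M s.
Proof.
move=> [h hM hE] sE.
have oM : flat 2 0 M.-1 (fun x => h x + -1 * h (M.-1 - x)%N).
  exact/(flatD hM)/flatZ/flat_rev.
have o_even x : (x <= M.-1)%N ->
    h x + -1 * h (M.-1 - x)%N = 2%:Z * ((h x + -1 * h (M.-1 - x)%N) %/ 2%:Z)%Z.
  move=> xM; rewrite [RHS]mulrC divzK //.
  have -> : h x + -1 * h (M.-1 - x)%N =
      (h x - h 0%N) - (h (M.-1 - x)%N - h 0%N) by ring.
  apply: rpredB; first exact: flat_modp hM xM.
  by apply: flat_modp hM _; apply: leq_subr.
exists (fun x => ((h x + -1 * h (M.-1 - x)%N) %/ 2%:Z)%Z).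
  by apply: flat_divp => //; apply: flat_ext oM => x xM; apply: o_even.
move=> x xM; rewrite (_ : 4%:Z = 2%:Z * 2%:Z) // -mulrA -o_even; last by lia.
have two_neq0 : 2%:Z != 0 by [].
apply: (mulfI two_neq0); rewrite mulrBr !sE ?(ltnW xM) //.
have -> : (M - x = (M.-1 - x).+1)%N by lia.
have -> : (M - x.+1 = M.-1 - x)%N by lia.
have hx := hE x xM; have hy : f (M.-1 - x).+1 - f (M.-1 - x)%N = 4%:Z * h (M.-1 - x)%N.
  by apply: hE; lia.
have -> : f x.+1 = 4%:Z * h x + f x by rewrite -hx; ring.
have -> : f (M.-1 - x).+1 = 4%:Z * h (M.-1 - x)%N + f (M.-1 - x)%N by rewrite -hy; ring.
by ring.
Qed.

Lemma odd_bin_unit r Q M k : odd (bin_unit 2 r Q M k).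
Proof.
have pf n : odd (fact_pfree 2 n) by rewrite -coprime2n coprime_fact_pfree.
by rewrite /bin_unit oddX oddM oddX oddM !pf !orbT.
Qed.

(** With [negb] the high digits drop out of [psum_step]. For even [M] only the digit 0 remains. For
    odd [M] the digits 0 and 1 are mirror images, so the new weight is twice an average: this yields
    one factor 2, and the average satisfies the hypotheses again. *)
Lemma psum2_mod s M g : (0 < s)%N -> (2%:Z %| g 0%N - 1)%Z -> qdiff 2 M g ->
  (forall k, (k <= M)%N -> g (M - k)%N = g k) ->
  ((2 ^ (odd_quotients 2 M).+1)%N%:Z %|
    psum 2 (2 * s) 1 negb M g - (2 ^ odd_quotients 2 M)%N%:Z)%Z.
Proof.
move=> s_gt0; elim/ltn_ind: M g => M IH g g_odd gM gS.
have [M0|M_gt0] := posnP M.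
  rewrite M0 /odd_quotients big_ord0 /psum big_mkcond big_ord1 /= bin0.
  by rewrite !expr1n !mul1r.
set v := odd_quotients 2 M; set low := low_digit_sum 2 (2 * s) v.+1 1 M g.
have step : ((2 ^ v.+1)%N%:Z %| psum 2 (2 * s) 1 negb M g -
    psum 2 (2 * s) 1 negb (M %/ 2) low)%Z.
  have := @psum_step 2 (2 * s) v.+1 1 isT _ (expr1n _ _) negb M g.
  by rewrite muln_gt0 s_gt0 !mul0r addr0; apply.
rewrite -(subrK (psum 2 (2 * s) 1 negb (M %/ 2) low) (psum _ _ _ _ M _)) -addrA.
apply: rpredD step _.
have M'M : (M %/ 2 < M)%N by rewrite ltn_Pdiv.
have lowS x : (x <= M %/ 2)%N -> low (M %/ 2 - x)%N = low x.
  move=> xM; rewrite /low low_digit_sum_sym ?expr1n ?mul1r //.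
  by move=> k kM; rewrite mul1r gS.
have vE : v = (odd M + odd_quotients 2 (M %/ 2))%N by rewrite /v odd_quotients_rec.
pose f x := (bin_unit 2 (2 * s) v.+1 M (2 * x))%:Z * g (2 * x)%N.
have defM : M = (2 * (M %/ 2) + odd M)%N by rewrite mulnC -modn2 -divn_eq.
have fM : qdiff 0 (M %/ 2) f.
  apply: qdiffM.
    apply: qdiff_ext (@qdiff_bin_unit s v.+1 M (M %/ 2) 0 (odd M) _ _ _) => //.
      by move=> x _; rewrite addn0.
    by case: odd.
  apply: qdiff_ext (@qdiff_decimate M (M %/ 2) 0 g _ gM); last by lia.
  by move=> x _; rewrite addn0.
have f0_odd : (2%:Z %| f 0%N - 1)%Z.
  rewrite /f muln0; set u := bin_unit _ _ _ _ _.
  have -> : u%:Z * g 0%N - 1 = u%:Z * (g 0%N - 1) + (u%:Z - 1) by ring.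
  apply: rpredD; first exact: dvdz_mull.
  have := odd_bin_unit (2 * s) v.+1 M 0; rewrite -/u; case: (u) => // u1 /= u1_even.
  by rewrite intS addrC addKr dvdzE /= dvdn2.
have [M_odd|M_even] := boolP (odd M); last first.
  have lowE x : low x = f x.
    rewrite /low /low_digit_sum modn2 (negPf M_even) big_ord1 mul1r addn0.
    by [].
  rewrite vE (negPf M_even) add0n; apply: IH => //; first by rewrite lowE.
  by apply/qdiff_succ/qdiff_succ; apply: qdiff_ext fM.
have lowE x : (x <= M %/ 2)%N -> low x = f x + f (M %/ 2 - x)%N.
  move=> xM; rewrite /low /low_digit_sum modn2 M_odd big_ord_recr big_ord1 /=.
  rewrite !mul1r addn0; congr (_ + _); rewrite /f.
  have -> : (2 * (M %/ 2 - x) = M - (2 * x + 1))%N by lia.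
  by rewrite bin_unit_sym ?gS //; lia.
have f_mod4 x : (x <= M %/ 2)%N -> (4%:Z %| f x - f 0%N)%Z := qdiff_mod4 fM.
have low_even x : (x <= M %/ 2)%N -> 2%:Z * (low x %/ 2%:Z)%Z = low x.
  move=> xM; rewrite mulrC divzK // lowE //.
  have -> : f x + f (M %/ 2 - x)%N =
      (f x - f 0%N) + (f (M %/ 2 - x)%N - f 0%N) + 2%:Z * f 0%N.
    by ring.
  apply: rpredD; last exact: dvdz_mulr.
  by apply: rpredD; apply: (@dvdz_trans 4%:Z) => //; apply: f_mod4; lia.
rewrite (@psum_ext _ _ _ _ _ _ (fun k => 2%:Z * (low k %/ 2%:Z)%Z)); last first.
  by move=> k kM; rewrite low_even.
rewrite psumZ vE M_odd add1n; set w := odd_quotients 2 (M %/ 2).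
have -> : (2 ^ w.+2)%N%:Z = 2%:Z * (2 ^ w.+1)%N%:Z by rewrite -PoszM -expnS.
rewrite [X in (_ %| _ - X)%Z](_ : _ = 2%:Z * (2 ^ w)%N%:Z); last first.
  by rewrite -PoszM -expnS.
rewrite -mulrBr; apply: dvdz_mul => //; apply: IH => //.
(* The average at 0 stays odd: [f (M %/ 2)] and [f 0] agree mod 4, so their mean is [f 0] plus an
   even number. *)
- have [t tE] : exists t, f (M %/ 2)%N = f 0%N + 4%:Z * t.
    have /dvdzP[t tE] := f_mod4 _ (leqnn _).
    by exists t; rewrite [4%:Z * t]mulrC -tE; ring.
  have -> : (low 0%N %/ 2%:Z)%Z = f 0%N + 2%:Z * t.
    have two_neq0 : 2%:Z != 0 by [].
    apply: (mulfI two_neq0); rewrite low_even // lowE // subn0 tE.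
    by ring.
  rewrite addrAC; apply: rpredD => //; exact: dvdz_mulr.
- by apply: qdiff_average fM _ => x xM; rewrite low_even // lowE.
by move=> k kM; rewrite lowS.
Qed.

End Two.

(** * From congruences to valuations *)

Lemma padic_val_congr p a (S u : int) : prime p ->
  ((p ^ a.+1)%N%:Z %| S - u)%Z -> padic_val p u = Some a ->
  padic_val p S = Some a.
Proof.
move=> p_prime dvd /(padic_valP _ _ p_prime) /andP[dvd_u ndvd_u].
apply/(padic_valP _ _ p_prime).
have dvdE m (z : int) : (m %| `|z|)%N = (m%:Z %| z)%Z by rewrite dvdzE.
rewrite !dvdE in dvd_u ndvd_u *; apply/andP; split.
  rewrite -[S](subrK u); apply: rpredD => //.
  by apply: dvdz_trans dvd; rewrite dvdzE /= dvdn_exp2l.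
by apply: contra ndvd_u => dvd_S; rewrite -[u](subKr S) rpredB.
Qed.

Lemma psum_split p r M : psum p r (-1) xpredT M (fun=> 1) =
  psum p r (-1) id M (fun=> 1) + psum p r (-1) negb M (fun=> 1).
Proof. by rewrite /psum (bigID (fun k : 'I_M.+1 => p %| 'C(M, k))%N). Qed.

(** With [a = logn p B], the left side is [(p - 1) * p ^ a]; here [p ^ a] divides [B], and [p - 1]
    divides [totient B] because [p] divides [B]. *)
Lemma dvd_totient_pfactor p B : prime p -> (p %| B)%N -> (0 < B)%N ->
  (totient (p ^ (logn p B).+1) %| totient B * B)%N.
Proof.
move=> p_prime p_dvd B_gt0; rewrite totient_pfactor //=.
have [m cop_m defB] := pfactor_coprime p_prime B_gt0.
apply: dvdn_mul; last exact: pfactor_dvdnn.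
rewrite defB totient_coprime ?coprimeXr 1?coprime_sym //.
rewrite (@totient_pfactor p) ?logn_gt0 ?mem_primes ?p_prime ?B_gt0 //.
by rewrite dvdn_mull // dvdn_mulr.
Qed.

Lemma psum_unit_periodic p Q r t M g : prime p ->
  ((p ^ Q)%N%:Z %| psum p (r + t * totient (p ^ Q)) (-1) negb M g -
    psum p r (-1) negb M g)%Z.
Proof.
move=> p_prime; rewrite /psum -sumrB; apply: rpred_sum => k ndvd.
rewrite -mulrBl -mulrBr; apply/dvdz_mulr/dvdz_mull.
rewrite -!PoszX -eqz_mod_dvd !modz_nat eqz_nat expnD mulnC.
have cop : coprime 'C(M, k) (p ^ Q) by rewrite coprime_sym coprimeXl // prime_coprime.
by rewrite [X in (_ ^ X)%N]mulnC expnM -modnMm -modnXm Euler_exp_totient //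
  modnXm exp1n modnMm mul1n.
Qed.

Local Close Scope ring_scope.

Theorem theorem1 (n r : nat) (n_gt0 : 0 < n) (r_gt0 : 0 < r)
    (r_mod : r = 2 %[mod totient 'C(2 * n, n) * 'C(2 * n, n)])
    (p : nat) (p_prime : prime p) (p_dvd : p %| 'C(2 * n, n)) :
  padic_val p (\sum_(0 <= k < (2 * n).+1) (-1) ^+ k * ('C(2 * n, k)%:Z) ^+ r)%R
  = padic_val p ('C(2 * n, n)%:Z)%R.
Proof.
set B := 'C(2 * n, n).
have B_gt0 : 0 < B by rewrite bin_gt0; lia.
set a := logn p B; set m := totient B * B.
have B_val : padic_val p B%:Z = Some a by rewrite /padic_val eqz_nat gtn_eqF.
have a_gt0 : 0 < a by rewrite logn_gt0 mem_primes p_prime B_gt0.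
have aE : a = odd_quotients p (2 * n) by apply: logn_central_bin.
(* [r = 1] would make the modulus divide 1, hence [B = 1], which has no prime divisor. *)
have r_ge2 : 1 < r.
  rewrite ltnNge; apply/negP => r_le1; have r1 : r = 1 by lia.
  have /eqP := r_mod; rewrite r1 eq_sym eqn_mod_dvd // subn1 dvdn1 muln_eq1.
  move=> /andP[_ /eqP B1]; move: p_dvd; rewrite B1 dvdn1 => /eqP p1.
  by move: p_prime; rewrite p1.
have [t rE] : exists t, r = 2 + t * m.
  have /eqP := r_mod; rewrite eqn_mod_dvd // => /dvdnP[t tE].
  by exists t; rewrite -tE subnKC.
have sumE s : (\sum_(0 <= k < (2 * n).+1) (-1) ^+ k * ('C(2 * n, k)%:Z) ^+ s =
    psum p s (-1) xpredT (2 * n) (fun=> 1))%R.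
  by rewrite big_mkord; apply: eq_bigr => k _; rewrite mulr1.
have S2_val : padic_val p (psum p 2 (-1) xpredT (2 * n) (fun=> 1%R)) = Some a.
  rewrite -sumE big_mkord sum_sqr_bin_alternating -B_val /padic_val.
  by rewrite mulrI_eq0 ?abszMsign //; apply/lregP; rewrite signr_eq0.
rewrite B_val sumE.
have const_sym M : ~~ odd M -> forall k, (k <= M)%N -> (1 = (-1) ^+ M * 1 :> int)%R.
  by move=> M_even k _; rewrite -signr_odd (negPf M_even).
have [p_odd|p_even] := boolP (odd p).
  apply: (padic_val_congr p_prime _ S2_val).
  have dvd_id s : 1 < s ->
      ((p ^ a.+1)%N%:Z %| psum p s (-1) id (2 * n) (fun=> 1))%Z%R.
    move=> s_gt1; have := @dvd_psum p s id (2 * n) (fun=> 1%R) p_prime p_odd s_gt1.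
    rewrite -aE addn1; apply; first exact: flat_cst.
    by apply: const_sym; rewrite oddM.
  (* Compare the exponents [r] and 2: the parts divisible by [p] vanish separately, and the unit
     parts agree because [totient (p ^ a.+1)] divides [m]. *)
  rewrite !psum_split opprD addrACA; apply: rpredD.
    by apply: rpredB; apply: dvd_id.
  have /dvdnP[u uE] := dvd_totient_pfactor p_prime p_dvd B_gt0.
  by rewrite rE /m uE mulnA; apply: psum_unit_periodic.
have p2 : p = 2 by case: (even_prime p_prime) p_even => // ->.
have [t0|t_gt0] := posnP t; first by rewrite rE t0 mul0n addn0.
(* The chain is [a < 2 ^ a <= B <= m <= t * m < r]. *)
have a_lt_r : a < r.
  have : 2 ^ a <= B by rewrite dvdn_leq // -p2 pfactor_dvdnn.
  have := ltn_expl a (isT : 1 < 2).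
  have : B <= m by rewrite leq_pmull // totient_gt0.
  by have := leq_pmull m t_gt0; rewrite rE; lia.
have [s rs] : exists s, r = 2 * s.
  have /dvdnP[b bE] := p_dvd; exists (1 + t * totient B * b).
  by rewrite rE /m /B bE p2; ring.
(* The reference value is now [2 ^ a], the residue supplied by [psum2_mod]; even terms vanish
   individually since [r > a]. *)
apply: (@padic_val_congr _ _ _ (2 ^ a)%N%:Z) => //; last first.
  by rewrite /padic_val eqz_nat gtn_eqF ?expn_gt0 //= p2 pfactorK.
rewrite psum_split -addrA; apply: rpredD.
  apply: rpred_sum => k dvd_k; rewrite mulr1; apply: dvdz_mull.
  by apply: (@dvdz_trans (p%:Z ^+ r)%R);
    [rewrite PoszX dvdz_exp2l | apply: dvdz_exp2r].
(* The last binary digit of [2 * n] is 0, so an odd binomial forces [k] even and the sign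
   disappears. *)
have -> : psum p r (-1) negb (2 * n) (fun=> 1%R) =
    psum 2 (2 * s) 1 negb (2 * n) (fun=> 1%R).
  rewrite -rs p2; apply: eq_bigr => k; rewrite dvdn_bin_digits //; last first.
    by rewrite -ltnS.
  rewrite !modn2 oddM /= negb_imply => /andP[k_even _].
  rewrite -[((-1) ^+ k)%R]signr_odd; case: (odd k) k_even => // _.
  by rewrite expr1n.
rewrite p2 aE p2; apply: psum2_mod => //; first by lia.
by exists (fun=> 0%R) => [|x _]; [apply: flat_cst | rewrite subrr mulr0].
Qed.
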